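(* For any integer $k\ge 1$ there exists a tree $T$ such that $\Gamma_b(T)-\alpha_{\mathrm{bnr}}(T)\ge k$.
   Context: All graphs are finite and simple. Let $d(u,v)$ denote distance and $e(v)$ the eccentricity of $v$. A broadcast on a connected graph $G=(V,E)$ is a function $f:V\to\{0,1,\dots,\operatorname{diam}(G)\}$ with $f(v)\le e(v)$ for all $v\in V$ if $|V|\ge 2$, and $f(v)=1$ if $V=\{v\}$. Let $V_f^+=\{v: f(v)>0\}$ and $\sigma(f)=\sum_{v\in V}f(v)$ (the weight). A vertex $u$ hears $f$ from $v\in V_f^+$ (and $v$ dominates $u$) if $d(u,v)\le f(v)$. $f$ is dominating if every vertex hears $f$ from some vertex of $V_f^+$. A dominating broadcast $f$ is minimal dominating if no broadcast $g\neq f$ with $g(v)\le f(v)$ for all $v$ is dominating. $\Gamma_b(G)$ is the maximum weight of a minimal dominating broadcast of $G$. For $v\in V_f^+$ let $N_f(v)=\{u:d(u,v)\le f(v)\}$, $B_f(v)=\{u:d(u,v)=f(v)\}$, and let the private boundary $\operatorname{PB}_f(v)$ be the set of $u\in N_f(v)$ that are not dominated by the function obtained from $f$ by changing the value at $v$ to $f(v)-1$. $f$ is irredundant if $\operatorname{PB}_f(v)\ne\varnothing$ for each $v\in V_f^+$. $f$ is bn-independent if $N_f(u)\cap N_f(v)\subseteq B_f(u)\cap B_f(v)$ for all distinct $u,v\in V_f^+$; it is bnr-independent if it is bn-independent and irredundant. $\alpha_{\mathrm{bnr}}(G)$ is the maximum weight of a bnr-independent broadcast on $G$. *)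

(* Defs.v *)
From HB Require Import structures.
From mathcomp Require Import all_boot.

Set Implicit Arguments.
Unset Strict Implicit.
Unset Printing Implicit Defensive.

Record sgraph := SGraph {
  vertex :> finType;
  adj : rel vertex;
  adj_sym : symmetric adj;
  adj_irrefl : irreflexive adj }.

Definition connected (G : sgraph) : Prop :=
  0 < #|G| /\ forall u v : G, connect (@adj G) u v.

(* [cycle] also holds of [::] and of [:: u; v] with u, v adjacent, hence the
   size condition. *)
Definition acyclic (G : sgraph) : Prop :=
  forall c : seq G, 2 < size c -> uniq c -> ~~ cycle (@adj G) c.

Definition is_tree (G : sgraph) : Prop := connected G /\ acyclic G.

Definition has_walk (G : sgraph) (u v : G) (n : nat) : bool :=
  [exists p : n.-tuple G, path (@adj G) u p && (last u p == v)].

(* The least length of a walk from u to v. In a connected graph it is less than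
   #|G|, so that the bounded search succeeds; the junk value #|G| occurs only
   when u and v lie in different components. *)
Definition dist (G : sgraph) (u v : G) : nat :=
  find (has_walk u v) (iota 0 #|G|).

Definition ecc (G : sgraph) (v : G) : nat := \max_(u : G) dist v u.

Definition diam (G : sgraph) : nat := \max_(v : G) ecc v.

(* On K_1 the diameter is 0 and the only broadcast is by convention the constant
   function 1. *)
Definition is_broadcast (G : sgraph) (f : G -> nat) : bool :=
  if 1 < #|G| then [forall v, (f v <= diam G) && (f v <= ecc v)]
  else [forall v, f v == 1].

Definition weight (G : sgraph) (f : G -> nat) : nat := \sum_(v : G) f v.

Definition hears (G : sgraph) (f : G -> nat) (u v : G) : bool :=
  (0 < f v) && (dist u v <= f v).

Definition dominated (G : sgraph) (f : G -> nat) (u : G) : bool :=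
  [exists v, hears f u v].

Definition dominating (G : sgraph) (f : G -> nat) : bool :=
  [forall u, dominated f u].

Definition nbh (G : sgraph) (f : G -> nat) (v : G) : {set G} :=
  [set u | dist u v <= f v].

Definition bdry (G : sgraph) (f : G -> nat) (v : G) : {set G} :=
  [set u | dist u v == f v].

Definition lower_at (G : sgraph) (f : G -> nat) (v : G) : G -> nat :=
  fun w => if w == v then (f w).-1 else f w.

Definition priv_bdry (G : sgraph) (f : G -> nat) (v : G) : {set G} :=
  [set u in nbh f v | ~~ dominated (lower_at f v) u].

Definition irredundant (G : sgraph) (f : G -> nat) : bool :=
  [forall v, (0 < f v) ==> (priv_bdry f v != set0)].

Definition bn_independent (G : sgraph) (f : G -> nat) : bool :=
  [forall u, forall v, [&& u != v, 0 < f u & 0 < f v] ==>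
    (nbh f u :&: nbh f v \subset bdry f u :&: bdry f v)].

Definition bnr_independent (G : sgraph) (f : G -> nat) : bool :=
  bn_independent f && irredundant f.

(* A finite type containing all broadcasts on G, so that the maxima below range
   over a finite type; the 1 accommodates the broadcast on K_1. *)
Definition bfun (G : sgraph) : finType :=
  {ffun G -> 'I_(maxn 1 (diam G)).+1}.

Definition bval (G : sgraph) (f : bfun G) : G -> nat := fun v => f v.

Definition minimal_dominating (G : sgraph) (f : bfun G) : bool :=
  [&& is_broadcast (bval f), dominating (bval f) &
    [forall g : bfun G,
      [&& is_broadcast (bval g), g != f & [forall v, bval g v <= bval f v]]
        ==> ~~ dominating (bval g)]].

Definition Gamma_b (G : sgraph) : nat :=
  \max_(f : bfun G | minimal_dominating f) weight (bval f).

Definition alpha_bnr (G : sgraph) : nat :=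
  \max_(f : bfun G | is_broadcast (bval f) && bnr_independent (bval f))
    weight (bval f).

(* Main.v *)
Require Import Defs.
From mathcomp Require Import all_boot zify.

(** The tree has a hub with [K] identical branches attached. A column is a path
0 - 1 - 2 - 3, attached at its vertex 1, so that it has a short arm of length 1
and a long arm of length 2. A branch consists of two columns whose attachment
vertices are adjacent; the attachment vertex of its near column is joined to the
hub.

Lower bound. Give the value 3 to the end 3 of each long arm. Its ball is its
whole column and the neighbours of the attachment vertex, and the end 0 of the
short arm, at distance 3, hears nothing else. The balls of the two columns of a
branch overlap in both attachment vertices, which is harmless for minimal
domination; each branch contributes 6 ([Gamma_ge]).

Upper bound. In a bn-independent broadcast distinct broadcasting vertices [u],
[v] satisfy [f u + f v <= dist u v]: otherwise the geodesic between them has a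
vertex in both balls that is not on both boundaries. Hence at most one ball has
the hub in its interior, and its value is at most 8, which bounds the distances
in the tree. All other balls are confined to a branch and may at most touch the
hub. Such balls have total weight at most 5 in each branch ([branch_bound]).
In outline: a column whose balls stop at its attachment vertex carries weight at
most 3, and 3 only as 1 at vertex 0 and 2 at vertex 3; then the only candidate
for the private boundary of vertex 3 is the attachment vertex, which also hears
vertex 0, so irredundance leaves at most 2. A ball passing the attachment vertex
by [t = 1] or [t = 2] raises the bound for its own column to [t + 2] but reaches
into the other column, whose bound falls to [3 - t].

So [Gamma_b - alpha_bnr >= 6 * K - (5 * K + 8)], and [K = k + 8] suffices. *)

(** * Walks and distances *)

Section Walks.
Variable G : sgraph.
Implicit Types u v w : G.

Lemma has_walkP u v n :
  reflect (exists p : seq G, [/\ size p = n, path (@adj G) u p & last u p = v])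
          (has_walk u v n).
Proof.
apply: (iffP existsP) => [[p /andP[pth /eqP lst]]|[p [/eqP sz pth lst]]].
  by exists p; rewrite size_tuple.
by exists (Tuple sz); rewrite pth lst eqxx.
Qed.

Lemma has_walk0 u : has_walk u u 0.
Proof. by apply/has_walkP; exists [::]. Qed.

Lemma has_walk_cat u w v m n :
  has_walk u w m -> has_walk w v n -> has_walk u v (m + n).
Proof.
move=> /has_walkP[p [<- pth <-]] /has_walkP[q [<- qth <-]].
by apply/has_walkP; exists (p ++ q); rewrite size_cat cat_path last_cat pth.
Qed.

Lemma has_walk1 u v : adj u v -> has_walk u v 1.
Proof. by move=> uv; apply/has_walkP; exists [:: v]; rewrite /= uv. Qed.

Lemma has_walk_sym u v n : has_walk u v n -> has_walk v u n.
Proof.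
move=> /has_walkP[p [<- pth <-]] {n v}.
elim/last_ind: p pth => [|p y IHp]; first by rewrite has_walk0.
rewrite rcons_path last_rcons size_rcons => /andP[/IHp wlk py].
by rewrite -add1n; apply: has_walk_cat wlk; apply: has_walk1; rewrite adj_sym.
Qed.

Lemma has_walk_connect u v n : has_walk u v n -> connect (@adj G) u v.
Proof. by move=> /has_walkP[p [_ pth lst]]; apply/connectP; exists p. Qed.

Lemma has_walk_split u v m n :
  has_walk u v (m + n) -> exists2 w, has_walk u w m & has_walk w v n.
Proof.
move=> /has_walkP[p [sz pth lst]].
move: sz pth lst; rewrite -{1 2 3}(cat_take_drop m p) size_cat => sz.
rewrite cat_path last_cat => /andP[pth qth] lst.
have szt : size (take m p) = m.
  by move: sz; rewrite -size_cat cat_take_drop => sz; rewrite size_takel ?sz ?leq_addr.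
exists (last u (take m p)); apply/has_walkP; first by exists (take m p).
by exists (drop m p); split=> //; lia.
Qed.

(** The search defining [dist] stops at [#|G|], so longer walks are covered too. *)
Lemma dist_le_walk u v n : has_walk u v n -> dist u v <= n.
Proof.
move=> wlk; rewrite /dist; case: (ltnP n #|G|) => [ltn | len].
  rewrite leqNgt; apply/negP => /(before_find 0).
  by rewrite nth_iota // add0n wlk.
by apply: leq_trans len; rewrite -[X in _ <= X](size_iota 0) find_size.
Qed.

Lemma walk_dist u v : dist u v < #|G| -> has_walk u v (dist u v).
Proof.
rewrite /dist => lt.
have := nth_find 0 (a := has_walk u v) (s := iota 0 #|G|).
by rewrite has_find size_iota nth_iota // add0n; apply.
Qed.

(** A function that changes by at most one along an edge bounds the length of
walks from below, so realizing it by walks forces it to be the distance. *)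
Lemma dist_unique (delta : G -> G -> nat) :
  (forall v, delta v v = 0) ->
  (forall u w v, adj u w -> delta u v <= (delta w v).+1) ->
  (forall u v, has_walk u v (delta u v)) ->
  (forall u v, delta u v < #|G|) ->
  forall u v, dist u v = delta u v.
Proof.
move=> d0 dS dw dlt u v; apply/eqP; rewrite eqn_leq dist_le_walk //=.
have /walk_dist: dist u v < #|G| by apply: leq_ltn_trans (dlt u v); apply: dist_le_walk.
move: (dist u v) => n /has_walkP[p [<- pth lst]] {n}.
elim: p u pth lst => [|w p IHp] u /= => [_ ->|/andP[uw pth] lst].
  by rewrite d0.
by apply: leq_trans (dS _ _ v uw) _; rewrite ltnS IHp.
Qed.

(** A highest vertex of a cycle would have two distinct neighbours on the cycle,
neither of them higher, so both would be its parent. *)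
Lemma parent_acyclic (par : G -> G) (h : G -> nat) :
  (forall u v, adj u v -> par u = v \/ h u < h v) -> acyclic G.
Proof.
move=> step c sz Uc; apply/negP => cyc.
have [x0 x0c] : exists x, x \in c by case: (c) sz => // x s _; exists x; rewrite mem_head.
case: (arg_maxnP (P := [in c]) h x0c) => v vc top.
have toplevel w : w \in c -> adj v w -> w = par v.
  by move=> /top; rewrite /= leqNgt => hw /step[<- //|lt]; rewrite lt in hw.
case: (rot_to vc) => i p def.
have mem w : w \in v :: p -> w \in c by rewrite -def mem_rot.
move: Uc cyc sz; rewrite -(rot_uniq i) -(rot_cycle i) -(size_rot i) def.
case/lastP: p {def} mem => [|p y] //; case: p => [|x p] // mem Uc cyc _.
have vx : adj v x by move: cyc => /= /andP[].
have yv : adj v y.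
  by move: cyc; rewrite /= rcons_path last_rcons => /and3P[_ _]; rewrite adj_sym.
have xE : x = par v.
  by apply: toplevel vx; apply: mem; rewrite !inE eqxx orbT.
have yE : y = par v.
  by apply: toplevel yv; apply: mem; rewrite in_cons mem_rcons mem_head orbT.
by move: Uc => /= /and3P[_]; rewrite mem_rcons xE yE mem_head.
Qed.

End Walks.

(** * Minimality and independence of broadcasts *)

Section Broadcasts.
Variable G : sgraph.

(** If the two values exceeded the distance, the vertex of a geodesic from [u] that
is nearest to [v] among those in the interior of the ball at [u] would also lie
in the ball at [v]. *)
Lemma bn_independent_dist (f : G -> nat) u v :
  bn_independent f -> u != v -> 0 < f u -> 0 < f v -> dist u v < #|G| ->
  f u + f v <= dist u v.
Proof.
move=> /forallP/(_ u)/forallP/(_ v)/implyP sub uv fu fv lt.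
rewrite leqNgt; apply/negP => close.
set i := minn (dist u v) (f u).-1.
have: has_walk u v (i + (dist u v - i)).
  by rewrite subnKC ?geq_minl // walk_dist.
move=> /has_walk_split[w /has_walk_sym/dist_le_walk wu /dist_le_walk wv].
have := sub; rewrite uv fu fv => /(_ isT)/subsetP/(_ w).
rewrite !inE => /(_ _)/andP[]; last by lia.
by apply/andP; split; lia.
Qed.

(** A dominating [g] below [f] and different from it is also below the function
obtained by lowering [f] at one vertex [v], which fails to dominate the private
boundary of [v]. *)
Lemma irredundant_minimal (f : bfun G) :
  is_broadcast (bval f) -> dominating (bval f) -> irredundant (bval f) ->
  minimal_dominating f.
Proof.
move=> brd dom irr; apply/and3P; split=> //.
apply/forallP => g; apply/implyP => /and3P[_ gf /forallP le]; apply/negP => gdom.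
case/eqP: gf; apply/ffunP => v; apply/val_inj/eqP; rewrite eqn_leq le leqNgt /=.
apply/negP => lt; have fv : 0 < bval f v by apply: leq_ltn_trans lt.
have /set0Pn[u] := implyP (forallP irr v) fv.
rewrite inE => /andP[_ /existsP[]].
have /existsP[w /andP[gw uw]] := forallP gdom u; exists w.
have gl : bval g w <= lower_at (bval f) v w.
  by rewrite /lower_at; case: eqP => [->|_]; [rewrite -ltnS prednK | apply: le].
by rewrite /hears (leq_trans gw gl) (leq_trans uw gl).
Qed.

End Broadcasts.

(** * The tree *)

(** Distance from position [i] of a column to its attachment vertex 1. *)
Definition arm (i : nat) : nat := (i - 1) + (1 - i).

Definition cell_dist (s : bool) (i : nat) (t : bool) (j : nat) : nat :=
  if s == t then (i - j) + (j - i) else arm i + 1 + arm j.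

(** Distance to the hub; the column [s = true] is the far one. *)
Definition depth (s : bool) (i : nat) : nat := arm i + 1 + s.

Section Tree.
Variable K : nat.

(** [None] is the hub; [Some (b, (s, i))] is position [i] of column [s] in branch
[b]. *)
Definition node : finType := option ('I_K * (bool * 'I_4)).

Definition height (u : node) : nat :=
  if u is Some (_, (s, i)) then depth s i else 0.

Definition parent (u : node) : node :=
  if u is Some (b, (s, i)) then
    match val i with
    | 1 => if s then Some (b, (false, i)) else None
    | 3 => Some (b, (s, inord 2))
    | _ => Some (b, (s, inord 1))
    end
  else None.

Definition tadj (u v : node) : bool :=
  (u != v) && ((parent u == v) || (parent v == u)).

Lemma tadj_sym : symmetric tadj.
Proof. by move=> u v; rewrite /tadj eq_sym orbC. Qed.

Lemma tadj_irrefl : irreflexive tadj.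
Proof. by move=> u; rewrite /tadj eqxx. Qed.

Definition tree : sgraph := SGraph tadj_sym tadj_irrefl.

(** Closed form of the distance, justified by [dist_tree]. *)
Definition tdist (u v : node) : nat :=
  match u, v with
  | Some (b, (s, i)), Some (c, (t, j)) =>
      if b == c then cell_dist s i t j else depth s i + depth t j
  | _, _ => height u + height v
  end.

Lemma parent_height u : u != None -> height (parent u) < height u.
Proof.
case: u => [[b [s [i lt]]]|] // _; rewrite /parent /height /depth /arm /=.
by case: i lt s => [|[|[|[|i]]]] // lt [] /=; rewrite ?inordK.
Qed.

Lemma tdist_parent u v :
  tdist u v <= (tdist (parent u) v).+1 /\ tdist (parent u) v <= (tdist u v).+1.
Proof.
case: u => [[b [s [i lti]]]|]; last by split.
case: v => [[c [t [j ltj]]]|] /=; rewrite /cell_dist /depth /arm /=.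
  by case: i lti s => [|[|[|[|i]]]] // lti []; case: j ltj t => [|[|[|[|j]]]] // ltj [];
    rewrite /= ?inordK //; case: (b == c).
by case: i lti s => [|[|[|[|i]]]] // lti [] /=; rewrite ?inordK.
Qed.

(** Of two distinct vertices at least one is not an ancestor of the other, and the
geodesic leaves that one through its parent. Climbing from whichever end allows
it spares describing the descending half of a geodesic. *)
Lemma tdist_climb u v : u != v ->
  u != None /\ tdist u v = (tdist (parent u) v).+1 \/
  v != None /\ tdist u v = (tdist u (parent v)).+1.
Proof.
case: u v => [[b [s [i lti]]]|] [[c [t [j ltj]]]|] //= uv; last 2 first.
- left; split=> //; rewrite /depth /arm.
  by case: i lti s {uv} => [|[|[|[|i]]]] // lti [] /=; rewrite ?inordK.
- right; split=> //; rewrite /depth /arm.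
  by case: j ltj t {uv} => [|[|[|[|j]]]] // ltj [] /=; rewrite ?inordK.
have [bc|bc] := eqVneq b c; last first.
  left; split=> //; move: bc; rewrite /cell_dist /depth /arm.
  by case: i lti s {uv} => [|[|[|[|i]]]] // lti [] /=; rewrite ?inordK // => /negbTE->.
have {uv}: (s, i) != (t, j).
  apply: contraNneq uv => -[-> ij]; rewrite bc; apply/eqP.
  by do 3 congr (_, _) || congr Some; apply: val_inj.
rewrite {}bc /cell_dist /depth /arm.
case: i lti s => [|[|[|[|i]]]] // lti [];
case: j ltj t => [|[|[|[|j]]]] // ltj [] /= ne; rewrite ?inordK ?eqxx //=;
  by [left | right | move: ne; rewrite eqxx].
Qed.

End Tree.

Arguments height {K} u.
Arguments parent {K} u.
Arguments tdist {K} u v.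
Arguments tdist_parent {K} u v.
Arguments tdist_climb {K} [u v].
Arguments parent_height {K} [u].

(** * Weights confined to one branch *)

(** Confined balls share no edge, and each covers at least as many edges of the
column as its value, save for the length by which it passes the attachment
vertex. A ball that does pass it gains up to [r] in this way, but it also enters
the other arm and so wastes an edge there: the three edges give [3 + r - 1]. *)
Lemma column_bound (f : nat -> nat) r :
  0 < r ->
  (forall i, i < 4 -> f i <= arm i + r) ->
  (forall i j, i < j < 4 -> 0 < f i -> 0 < f j -> f i + f j <= j - i) ->
  f 0 + f 1 + f 2 + f 3 <= r + 2.
Proof.
rewrite /arm => r_gt0 bnd ind.
move: (bnd 0 isT) (bnd 1 isT) (bnd 2 isT) (bnd 3 isT).
move: (ind 0 1 isT) (ind 0 2 isT) (ind 0 3 isT) (ind 1 2 isT) (ind 1 3 isT) (ind 2 3 isT).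
lia.
Qed.

(** When no ball passes the attachment vertex, weight 3 would need 1 at position 0
and 2 at position 3; the last hypothesis excludes this. *)
Lemma idle_column_bound (f : nat -> nat) :
  (forall i, i < 4 -> f i <= arm i) ->
  (forall i j, i < j < 4 -> 0 < f i -> 0 < f j -> f i + f j <= j - i) ->
  (0 < f 0 -> f 3 != 2) ->
  f 0 + f 1 + f 2 + f 3 <= 2.
Proof.
rewrite /arm => bnd ind irr.
move: (bnd 0 isT) (bnd 1 isT) (bnd 2 isT) (bnd 3 isT) irr.
move: (ind 0 1 isT) (ind 0 2 isT) (ind 0 3 isT) (ind 1 2 isT) (ind 1 3 isT) (ind 2 3 isT).
lia.
Qed.

(** In the last hypothesis, a value 2 at position 3 needs the attachment vertex as
private boundary: it is the only vertex at distance exactly 2. At most one of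
the columns has a ball passing its attachment vertex; what such a ball, passing
by [t], gains in its own column it takes from the other one. *)
Lemma branch_bound (f : bool -> nat -> nat) :
  (forall s i, i < 4 -> f s i <= depth s i) ->
  (forall s i t j, i < 4 -> j < 4 -> (s, i) != (t, j) -> 0 < f s i -> 0 < f t j ->
     f s i + f t j <= cell_dist s i t j) ->
  (forall s t j, f s 3 = 2 -> j < 4 -> (t, j) != (s, 3) -> 0 < f t j ->
     f t j < cell_dist s 1 t j) ->
  \sum_s \sum_(i < 4) f s i <= 5.
Proof.
move=> bnd ind irr.
rewrite big_bool !big_ord_recr !big_ord0 /= !add0n.
have col s i j : i < j < 4 -> 0 < f s i -> 0 < f s j -> f s i + f s j <= j - i.
  move=> /andP[ij j4] fi fj.
  have ne : (s, i) != (s, j) by rewrite xpair_eqE eqxx ltn_eqF.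
  by have := ind s i s j (ltn_trans ij j4) j4 ne fi fj; rewrite /cell_dist eqxx; lia.
have irr0 s : 0 < f s 0 -> f s 3 != 2.
  move=> f0; apply/eqP => f3; have := irr s s 0 f3 isT.
  by rewrite xpair_eqE eqxx /cell_dist eqxx => /(_ isT f0); lia.
have [crossing|idle] :=
  boolP [exists s, [exists i : 'I_4, arm i < f s i]]; last first.
  suff idle2 s : f s 0 + f s 1 + f s 2 + f s 3 <= 2.
    by apply: leq_trans (leq_add (idle2 _) (idle2 _)) _.
  apply: idle_column_bound (col s) (irr0 s) => i i4.
  move: idle; rewrite negb_exists => /forallP/(_ s).
  by rewrite negb_exists => /forallP/(_ (Ordinal i4)); rewrite -leqNgt.
have [s /existsP[[i i4] /= si]] := existsP crossing.
have [t ft t12] : exists2 t, f s i = arm i + t & 0 < t <= 1 + s.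
  by exists (f s i - arm i); have := bnd s i i4; rewrite /depth; lia.
(* Two balls of one column cannot both pass the attachment vertex, so [t] bounds
the overshoot of all of them. *)
have own : f s 0 + f s 1 + f s 2 + f s 3 <= t + 2.
  have t_gt0 : 0 < t by case/andP: t12.
  apply: column_bound t_gt0 _ (col s) => j j4.
  have [->|ji] := eqVneq j i; first by rewrite ft.
  have [->//|fj] := posnP (f s j).
  have ne : (s, j) != (s, i) by rewrite xpair_eqE eqxx.
  have := ind s j s i j4 i4 ne fj (leq_ltn_trans (leq0n _) si).
  by rewrite /cell_dist eqxx /arm in ft *; lia.
have far j : j < 4 -> f (~~ s) j <= arm j + 1 - t.
  move=> j4; have [->//|fj] := posnP (f (~~ s) j).
  have ne : (~~ s, j) != (s, i) by rewrite xpair_eqE; case: (s).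
  have := ind (~~ s) j s i j4 i4 ne fj (leq_ltn_trans (leq0n _) si).
  by rewrite /cell_dist; case: eqP => [|_]; [case: (s) | lia].
(* The ball of [i] covers the attachment vertex of the other column, which excludes
the value 2 at position 3 there. *)
have other : f (~~ s) 0 + f (~~ s) 1 + f (~~ s) 2 + f (~~ s) 3 <= 3 - t.
  have f3 : f (~~ s) 3 != 2.
    apply/eqP => f3; have := irr (~~ s) s i f3 i4; rewrite xpair_eqE.
    have -> : (s == ~~ s) = false by case: (s).
    move=> /(_ isT (leq_ltn_trans (leq0n _) si)); rewrite /cell_dist.
    by case: eqP => [|_]; [case: (s) | rewrite /arm in si *; lia].
  have [t1|t2] : t = 1 \/ t = 2 by move: t12; case: (s); lia.
    rewrite t1; apply: idle_column_bound (col (~~ s)) (irr0 (~~ s)) => j j4.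
    by rewrite -[arm j](addnK 1) -{2}t1; apply: far.
  move: (far 0 isT) (far 1 isT) (far 2 isT) (far 3 isT) f3.
  by rewrite t2 /arm; lia.
by move: own other t12; case: (s) => /=; lia.
Qed.

(** * The metric of the tree *)

Section Metric.
Variables (K : nat) (K_gt0 : 0 < K).
Local Notation T := (tree K).
Implicit Types (u v w : T).

Lemma sum_node (F : T -> nat) :
  \sum_u F u = F None + \sum_(b < K) \sum_s \sum_(i < 4) F (Some (b, (s, i))).
Proof.
rewrite (bigD1 None) //=; congr (_ + _).
rewrite (reindex_omap Some id) /=; last by case.
rewrite (eq_bigl predT) => [|x]; last by rewrite /= eqxx.
rewrite pair_bigA /= (pair_bigA _ (fun p i => F (Some (p.1, (p.2, i))))) /=.
rewrite (reindex (fun p : 'I_K * bool * 'I_4 => (p.1.1, (p.1.2, p.2)))) //=.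
by exists (fun p => (p.1, p.2.1, p.2.2)) => [[[b s] i]|[b [s i]]].
Qed.

Lemma card_tree : #|T| = (K * 8).+1.
Proof. by rewrite /= card_option !card_prod card_bool !card_ord. Qed.

Lemma adj_parent u : u != None -> adj u (parent u).
Proof.
move=> /parent_height lt; rewrite /= /tadj eqxx andbT.
by apply: contraTneq lt => <-; rewrite ltnn.
Qed.

Lemma adj_climb u v : adj u v -> parent u = v \/ height u < height v.
Proof.
rewrite /= /tadj => /andP[uv /orP[/eqP|/eqP vu]]; first by left.
right; rewrite -vu; apply: parent_height.
by apply: contraNneq uv => vN; rewrite -vu vN.
Qed.

Lemma height_le u : height u <= 4.
Proof. by case: u => [[b [s [i lt]]]|] //=; rewrite /depth /arm; case: s; lia. Qed.

Lemma tdist_hub u v : tdist u v <= height u + height v.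
Proof.
case: u v => [[b [s i]]|] [[c [t j]]|] //=; case: (b == c) => //.
by rewrite /cell_dist /depth /arm; case: eqP => _; lia.
Qed.

Lemma tdist_walk u v : @has_walk T u v (tdist u v).
Proof.
move dE: (tdist u v) => n.
elim: n u v dE => [|n IHn] u v dE.
  have [->|/tdist_climb[][_]] := eqVneq u v; first exact: has_walk0.
    by rewrite dE.
  by rewrite dE.
have [uv|/tdist_climb[][ne]] := eqVneq u v.
- move: dE; rewrite uv; case: (v) => [[b [s i]]|] //=.
  by rewrite eqxx /cell_dist eqxx; lia.
- rewrite dE => -[/esym/IHn]; rewrite -add1n; apply: has_walk_cat.
  exact/has_walk1/adj_parent.
- rewrite dE => -[/esym/IHn walk]; rewrite -addn1; apply: has_walk_cat walk _.
  by apply/has_walk_sym/has_walk1/adj_parent.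
Qed.

Lemma dist_tree u v : dist u v = tdist u v.
Proof.
apply: dist_unique => {u v} [v|u w v|u v|u v].
- by case: v => [[b [s i]]|] //=; rewrite eqxx /cell_dist eqxx; lia.
- move=> /andP[_ /orP[] /eqP <-]; first by have [] := tdist_parent u v.
  by have [] := tdist_parent w v.
- exact: tdist_walk.
- have := tdist_hub u v; have := height_le u; have := height_le v.
  by rewrite card_tree; lia.
Qed.

Lemma tree_is_tree : is_tree T.
Proof.
split; last exact: parent_acyclic adj_climb.
split=> [|u v]; first by rewrite card_tree.
exact: has_walk_connect (tdist_walk u v).
Qed.

(** * The lower bound for the upper broadcast domination number *)

Definition tip_cast (u : T) : nat :=
  if u is Some (_, (_, i)) then if val i == 3 then 3 else 0 else 0.

Lemma ecc_ge u v : tdist u v <= ecc u.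
Proof. by rewrite -dist_tree; apply: (leq_bigmax v). Qed.

Lemma tip_cast_ecc v : tip_cast v <= ecc v.
Proof.
case: v => [[b [s i]]|] //=; case: eqP => // i3.
have := ecc_ge (Some (b, (s, i))) (Some (b, (s, ord0))).
by rewrite /= eqxx /cell_dist eqxx i3.
Qed.

Lemma tip_cast_gt0 v : 0 < tip_cast v -> exists b s i, v = Some (b, (s, i)) /\ val i = 3.
Proof. by case: v => [[b [s i]]|] //=; case: eqP => // i3 _; exists b, s, i. Qed.

Lemma dominating_tip_cast : dominating tip_cast.
Proof.
apply/forallP => -[[b [s i]]|]; apply/existsP.
  exists (Some (b, (s, ord_max))); rewrite /hears dist_tree /= eqxx /cell_dist eqxx.
  by have := ltn_ord i; lia.
by exists (Some (Ordinal K_gt0, (false, ord_max))); rewrite /hears dist_tree.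
Qed.

(** The private boundary is the end of the short arm of the same column. *)
Lemma irredundant_tip_cast : irredundant tip_cast.
Proof.
apply/forallP => v; apply/implyP => /tip_cast_gt0[b [s [i [-> i3]]]].
apply/set0Pn; exists (Some (b, (s, ord0))).
rewrite inE; apply/andP; split.
  by rewrite inE dist_tree /= eqxx /cell_dist eqxx i3.
apply/negP => /existsP[w /andP[]]; rewrite dist_tree /lower_at.
case: eqP => [->|wv].
  by rewrite /= i3 /cell_dist !eqxx.
move=> /tip_cast_gt0[c [t [j [wE j3]]]]; rewrite wE /= j3 /=.
case: eqP => [bc|_]; last by rewrite /depth /arm; lia.
rewrite /cell_dist; case: eqP => [st|_] //.
by case: wv; rewrite wE bc st; congr (Some (_, (_, _))); apply: val_inj; rewrite i3.
Qed.

Lemma Gamma_ge : 6 * K <= Gamma_b T.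
Proof.
have tip_cast_diam v : tip_cast v <= diam T.
  by apply: leq_trans (tip_cast_ecc v) (leq_bigmax v).
pose f : bfun T := [ffun v => inord (tip_cast v)].
have fE v : bval f v = tip_cast v.
  by rewrite /bval ffunE inordK // ltnS (leq_trans (tip_cast_diam v)) ?leq_maxr.
have lowE v w : lower_at (bval f) v w = lower_at tip_cast v w by rewrite /lower_at fE.
apply: leq_trans (leq_bigmax_cond f _); last first.
  apply: irredundant_minimal.
  - rewrite /is_broadcast card_tree ifT; last by lia.
    by apply/forallP => v; rewrite !fE tip_cast_diam tip_cast_ecc.
  - apply/forallP => u; have /existsP[v uv] := forallP dominating_tip_cast u.
    by apply/existsP; exists v; rewrite /hears fE.
  - apply/forallP => v; apply/implyP; rewrite fE => /(implyP (forallP irredundant_tip_cast v)).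
    move=> /set0Pn[u]; rewrite !inE => /andP[uv priv].
    apply/set0Pn; exists u; rewrite !inE fE uv.
    apply: contra priv => /existsP[w uw]; apply/existsP; exists w.
    by move: uw; rewrite /hears lowE.
rewrite /weight (eq_bigr tip_cast) => [|v _]; last exact: fE.
rewrite sum_node /= add0n (eq_bigr (fun=> 6)) => [|b _].
  by rewrite sum_nat_const card_ord mulnC.
by rewrite big_bool !big_ord_recr !big_ord0.
Qed.

(** * The upper bound for bnr-independent broadcasts *)

Section Alpha.
Variable f : T -> nat.
Hypotheses (f_brd : is_broadcast f) (f_bn : bn_independent f) (f_irr : irredundant f).

Lemma sum_disjoint u v : u != v -> 0 < f u -> 0 < f v -> f u + f v <= tdist u v.
Proof.
move=> uv fu fv; rewrite -dist_tree; apply: bn_independent_dist => //.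
rewrite dist_tree card_tree.
by have := tdist_hub u v; have := height_le u; have := height_le v; lia.
Qed.

Lemma f_le8 v : f v <= 8.
Proof.
move: f_brd; rewrite /is_broadcast card_tree ifT; last by lia.
move=> /forallP/(_ v)/andP[_ /leq_trans]; apply.
apply/bigmax_leqP => u _; rewrite dist_tree.
by have := tdist_hub v u; have := height_le u; have := height_le v; lia.
Qed.

(** The part of [f] whose balls do not have the hub in their interior; such a ball
lies in a single branch, up to the hub itself. *)
Definition confined v := if f v <= height v then f v else 0.
Definition overreach v := if f v <= height v then 0 else f v.

(** Two balls with the hub in their interior would be too close to each other, so at
most one vertex contributes. *)
Lemma overreach_bound : \sum_v overreach v <= 8.
Proof.
have [/existsP[v fv]|none] := boolP [exists v, height v < f v]; last first.
  rewrite big1 // => v _; rewrite /overreach ifT // leqNgt.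
  by move: none; rewrite negb_exists => /forallP.
rewrite (bigD1 v) //= big1 => [|u uv].
  by rewrite addn0 /overreach ifN -?ltnNge ?f_le8.
rewrite /overreach; case: leqP => // fu.
have := sum_disjoint _ _ uv (leq_ltn_trans (leq0n _) fu) (leq_ltn_trans (leq0n _) fv).
by have := tdist_hub u v; lia.
Qed.

(** The private boundary of [Some (b, (s, i))], the end of a long arm, lies at
distance exactly 2 from it, and the attachment vertex of its column is the only
vertex there. *)
Lemma private_attach b s i : val i = 3 -> f (Some (b, (s, i))) = 2 ->
  forall v, v != Some (b, (s, i)) -> 0 < f v ->
  f v < tdist (Some (b, (s, inord 1))) v.
Proof.
set u := Some _ => i3 fu v vu fv.
have u_gt0 : 0 < f u by rewrite fu.
have /set0Pn[w] := implyP (forallP f_irr u) u_gt0.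
rewrite !inE dist_tree fu => /andP[wu /existsP nd].
have wu1 : 1 < tdist w u.
  rewrite ltnNge; apply/negP => le; apply: nd; exists u.
  by rewrite /hears dist_tree /lower_at eqxx fu.
have wv : f v < tdist w v.
  rewrite ltnNge; apply/negP => le; apply: nd; exists v.
  by rewrite /hears dist_tree /lower_at (negbTE vu) fv.
suff <- : w = Some (b, (s, inord 1)) by [].
move: wu wu1; case: (w) => [[c [t j]]|] /=; last by rewrite /depth i3 /arm; lia.
rewrite i3; have [->|] := eqVneq c b; last by rewrite /depth /arm; lia.
rewrite /cell_dist /arm; have [-> le ge|] := eqVneq t s; last by lia.
by congr (Some (_, (_, _))); apply: val_inj; rewrite /= inordK //; have := ltn_ord j; lia.
Qed.

Lemma confined_bound b : \sum_s \sum_(i < 4) confined (Some (b, (s, i))) <= 5.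
Proof.
pose cell s n : T := Some (b, (s, inord n)).
rewrite (eq_bigr (fun s => \sum_(i < 4) confined (cell s i))) => [|s _]; last first.
  by apply: eq_bigr => i _; rewrite /cell inord_val.
have conf v : 0 < confined v -> 0 < f v /\ confined v = f v.
  by rewrite /confined; case: ifP.
have cellE s i t j : i < 4 -> j < 4 -> (cell s i == cell t j) = ((s, i) == (t, j)).
  move=> i4 j4; apply/eqP/eqP => [[-> /(congr1 val) /=]|[-> ->] //].
  by rewrite !inordK // => ->.
have cell_tdist s i t j : i < 4 -> j < 4 -> tdist (cell s i) (cell t j) = cell_dist s i t j.
  by move=> i4 j4; rewrite /= eqxx !inordK.
apply: (branch_bound (fun s i => confined (cell s i))) => [s i i4|s i t j i4 j4 ne|s t j].
- by rewrite /confined /= inordK //; case: ifP.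
- move=> /conf[fi ->] /conf[fj ->]; rewrite -cell_tdist //.
  by apply: sum_disjoint; rewrite ?cellE.
- move=> f3 j4 ne /conf[fj ->]; rewrite -cell_tdist //.
  have [_ f3E] : 0 < f (cell s 3) /\ confined (cell s 3) = f (cell s 3) by apply: conf; rewrite f3.
  rewrite f3E in f3; apply: (private_attach b s (inord 3) _ f3 _ _ fj); first by rewrite /= inordK.
  by rewrite -/(cell s 3) cellE.
Qed.

Lemma weight_le : weight f <= 5 * K + 8.
Proof.
rewrite /weight (eq_bigr (fun v => confined v + overreach v)) => [|v _]; last first.
  by rewrite /confined /overreach; case: ifP; rewrite ?addn0.
rewrite big_split /= leq_add ?overreach_bound // sum_node.
have -> : confined None = 0 by rewrite /confined /= leqn0; case: eqP.
rewrite add0n mulnC -[X in X * _](card_ord K) -sum_nat_const.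
by apply: leq_sum => b _; apply: confined_bound.
Qed.

End Alpha.

Lemma alpha_le : alpha_bnr T <= 5 * K + 8.
Proof.
apply/bigmax_leqP => f /and3P[brd bn irr]; exact: weight_le.
Qed.

End Metric.

Theorem theorem4p3 (k : nat) (hk : 1 <= k) :
  exists T : sgraph, is_tree T /\ k <= Gamma_b T - alpha_bnr T.
Proof.
exists (tree (k + 8)); have K_gt0 : 0 < k + 8 by rewrite addn_gt0 orbT.
split; first exact: tree_is_tree.
by have := Gamma_ge _ K_gt0; have := alpha_le _ K_gt0; lia.
Qed.
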